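(* Let $\mathcal X$ be a normed space with norm $\|\cdot\|_{\mathcal X}$. Assume the map $\mathcal T:\mathcal X\to\mathcal X$ has a fixed point $u^\star$ and is a contraction with modulus $0<L_{\mathcal T}<1$ on a closed invariant ball $\mathbb B_{\rm Pic}\subset\mathcal X$ containing the iterates, where the iterates $u^{\ell+1}:=\widehat{\mathcal T}_\ell(u^\ell)$ satisfy $$\|\widehat{\mathcal T}_\ell(u^\ell)-\mathcal T(u^\ell)\|_{\mathcal X}\le\delta_{{\rm Pic},\ell}.$$ Then for $n\ge1$ the iterates satisfy $$\|u^n-u^\star\|_{\mathcal X}\le L_{\mathcal T}^n\|u^0-u^\star\|_{\mathcal X}+\sum_{\ell=0}^{n-1}L_{\mathcal T}^{n-1-\ell}\delta_{{\rm Pic},\ell}.$$ If $\delta_{{\rm Pic},\ell}\le\delta_{\rm Pic}$ for $0\le\ell<n$, the accumulated inner-solve error (the sum on the right-hand side) is bounded by $(1-L_{\mathcal T}^n)\delta_{\rm Pic}/(1-L_{\mathcal T})$.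
   Context: $\mathcal X$ is a solution space whose norm controls the nonlinear terms of a semilinear elliptic PDE (including gradients when needed); $\mathcal T$ is the exact update map of a successive linearization of that PDE, and $\widehat{\mathcal T}_\ell$ is the inexact numerical (random-feature least-squares) inner solve at step $\ell\ge0$, started from $u^0$. Contraction with modulus $L_{\mathcal T}$ on $\mathbb B_{\rm Pic}$ means $\|\mathcal T(v)-\mathcal T(w)\|_{\mathcal X}\le L_{\mathcal T}\|v-w\|_{\mathcal X}$ for $v,w\in\mathbb B_{\rm Pic}$; invariant means $\mathcal T(\mathbb B_{\rm Pic})\subseteq\mathbb B_{\rm Pic}$.
   Formalization: The fixed point u* is assumed to lie in the ball B_Pic, which the text does not say explicitly; without this the claim fails (e.g. T x = x/2 on [-1,1], T 5 = 5, u* = 5, all iterates 0, all errors 0). *)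

(* Defs.v *)
From mathcomp Require Export all_boot all_order all_algebra.
From mathcomp Require Export all_classical all_reals all_analysis.

Set Implicit Arguments.
Unset Strict Implicit.
Unset Printing Implicit Defensive.

(* Main.v *)
(* One inexact step gives e_{n+1} <= L e_n + delta_n for the error
   e_n = |u_n - u*|, and the discounted sum S_n of the delta_l is exactly the
   solution of S_{n+1} = L S_n + delta_n started at 0; so is the closed form
   (1 - L^n) a / (1 - L) for constant delta_l = a. *)
Require Import Defs.
From mathcomp Require Import all_boot all_order all_algebra.
From mathcomp Require Import all_classical all_reals all_analysis.
From mathcomp Require Import zify ring lra.
Import Order.TTheory GRing.Theory Num.Theory.
Import numFieldNormedType.Exports.

Local Open Scope classical_set_scope.
Local Open Scope ring_scope.

(** The last term has weight [L ^+ 0 = 1]; every earlier weight gains exactly one factor [L]. *)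
Lemma discounted_sum_recr (R : nzRingType) (L : R) (d : nat -> R) (n : nat) :
  \sum_(0 <= l < n.+1) L ^+ (n.+1 - 1 - l) * d l =
  L * (\sum_(0 <= l < n) L ^+ (n - 1 - l) * d l) + d n.
Proof.
rewrite big_nat_recr //= subn1 subnn expr0 mul1r mulr_sumr; congr (_ + _).
apply: eq_big_nat => l /andP[_ ltln].
(* The truncated subtractions agree because [l < n]. *)
by rewrite mulrA -exprS; congr (_ ^+ _ * _); lia.
Qed.

Lemma perturbed_iteration_le (R : realType) (X : normedModType R) (B : set X)
    (T : X -> X) (L : R) (u : nat -> X) (x : X) (d : nat -> R) (n : nat) :
  0 <= L -> L.-lipschitz_B T -> T x = x -> B x -> (forall l, B (u l)) ->
  (forall l, `|u l.+1 - T (u l)| <= d l) ->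
  `|u n - x| <= L ^+ n * `|u 0%N - x|
                + \sum_(0 <= l < n) L ^+ (n - 1 - l) * d l.
Proof.
move=> L_ge0 T_lip Tx Bx Bu du.
elim: n => [|n IHn]; first by rewrite big_nil expr0 mul1r addr0.
have T_contr : `|T (u n) - x| <= L * `|u n - x|.
  (* Reading [x] as [T x] makes the left side a distance between two images of points of [B]. *)
  by rewrite -[in leLHS]Tx; apply: (T_lip (u n, x)); split; [exact: Bu | exact: Bx].
(* The bound becomes [d n] plus [L] times the bound at [n], matching the two legs of the triangle
   inequality through [T (u n)]. *)
rewrite discounted_sum_recr exprS -mulrA addrA -mulrDr addrC.
apply: le_trans (ler_distD (T (u n)) _ _) _; apply: lerD (du n) _.
exact: le_trans T_contr (ler_wpM2l L_ge0 IHn).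
Qed.

Lemma discounted_sum_le (R : realFieldType) (L a : R) (d : nat -> R) (n : nat) :
  0 <= L -> L < 1 -> (forall l, (l < n)%N -> d l <= a) ->
  \sum_(0 <= l < n) L ^+ (n - 1 - l) * d l <= (1 - L ^+ n) * a / (1 - L).
Proof.
move=> L_ge0 L_lt1 d_le; have L_neq1 : 1 - L != 0 by lra.
elim: n d_le => [|n IHn] d_le.
  by rewrite big_nil expr0 subrr !mul0r.
(* This rests on [1 - L ^+ n.+1 = L * (1 - L ^+ n) + (1 - L)]. *)
have -> : (1 - L ^+ n.+1) * a / (1 - L) =
          L * ((1 - L ^+ n) * a / (1 - L)) + a by rewrite exprS; field.
rewrite discounted_sum_recr; apply: lerD; last exact: d_le.
by apply/ler_wpM2l/IHn => // l ltln; exact/d_le/ltnW.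
Qed.

Theorem theorem4p11 (R : realType) (X : normedModType R)
    (T : X -> X) (That : nat -> X -> X) (u : nat -> X) (ustar : X)
    (L : R) (delta : nat -> R) (c : X) (r : R) (B : set X)
    (hB : B = closed_ball_ Num.norm c r)
    (ustar_fix : T ustar = ustar) (ustar_in : B ustar)
    (hL0 : 0 < L) (hL1 : L < 1)
    (T_contr : L.-lipschitz_B T)
    (T_inv : T @` B `<=` B)
    (u_step : forall l, u l.+1 = That l (u l))
    (u_in : forall l, B (u l))
    (inexact : forall l, `|That l (u l) - T (u l)| <= delta l)
    (n : nat) (hn : (1 <= n)%N) :
  `|u n - ustar| <= L ^+ n * `|u 0%N - ustar|
                    + \sum_(0 <= l < n) L ^+ (n - 1 - l) * delta l
  /\ (forall deltaPic : R,
        (forall l, (l < n)%N -> delta l <= deltaPic) ->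
        \sum_(0 <= l < n) L ^+ (n - 1 - l) * delta l
          <= (1 - L ^+ n) * deltaPic / (1 - L)).
Proof.
split=> [|a]; last exact: (discounted_sum_le _ _ _ _ _ (ltW hL0) hL1).
apply: (perturbed_iteration_le _ _ _ _ _ _ _ _ _ (ltW hL0) T_contr) => // l.
by rewrite u_step.
Qed.
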